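(* Let $\nu>-1/2$, $0\le\alpha<1$ and $0\le\lambda<1$. Suppose that $$\lambda S_\nu''(1)+(1-\lambda\alpha+2\lambda)S_\nu'(1)+(1-\alpha)S_\nu(1)\le 2(1-\alpha).$$ Then the normalized Bessel-Struve kernel function $z\mapsto zS_\nu(z)$ belongs to $\mathcal{T}_\lambda(\alpha)$.
   Context: Let $\mathbb{D}=\{z\in\mathbb{C}:|z|<1\}$. $\mathcal{A}$ denotes the class of functions $f$ analytic and univalent (injective) in $\mathbb{D}$, normalized by $f(0)=0$, $f'(0)=1$. For $\nu>-1$ the Bessel-Struve kernel function is the entire function $$S_\nu(z)=\sum_{n\ge 0}\frac{\Gamma(\nu+1)\,\Gamma\left(\frac{n+1}{2}\right)}{\sqrt{\pi}\,n!\,\Gamma\left(\frac n2+\nu+1\right)}z^n .$$ For $0\le\alpha<1$ and $0\le\lambda<1$, $$\mathcal{T}_\lambda(\alpha)=\left\{f\in\mathcal{A}:\ \operatorname{Re}\left(\frac{zf'(z)+\lambda z^2f''(z)}{(1-\lambda)f(z)+\lambda zf'(z)}\right)>\alpha\ \text{ for all } z\in\mathbb{D}\right\},$$ where the quotient is understood to have the value $1$ at $z=0$ (removable singularity). *)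

(* Defs.v *)
From HB Require Import structures.
From mathcomp Require Export all_boot all_order all_algebra.
From mathcomp Require Export all_classical all_reals all_analysis.
From mathcomp Require Export complex.
Export Order.TTheory GRing.Theory Num.Theory.
Export numFieldNormedType.Exports.

Set Implicit Arguments.
Unset Strict Implicit.
Unset Printing Implicit Defensive.

Local Open Scope classical_set_scope.
Local Open Scope complex_scope.
Local Open Scope ring_scope.

(* R[i] seen as an abstract numClosedFieldType: it is through this structure
   that the topology, the norm and the (complex) derivative are inferred. *)
Definition Cplx (R : realType) : numClosedFieldType := R[i].

Definition RtoC (R : realType) (x : R) : Cplx R := x%:C.

(* Euler's integral, meaningful for 0 < x only; this covers every use below
   when -1 < nu. *)
Definition Gamma (R : realType) (x : R) : R :=
  \int[@lebesgue_measure R]_(t in `]0, +oo[) (t `^ (x - 1) * expR (- t)).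

Definition bessel_struve_coef (R : realType) (nu : R) (n : nat) : R :=
  Gamma (nu + 1) * Gamma (n.+1%:R / 2) /
  (Num.sqrt pi * n`!%:R * Gamma (n%:R / 2 + nu + 1)).

Definition bessel_struve (R : realType) (nu : R) (z : Cplx R) : Cplx R :=
  limn (series (fun n : nat => RtoC (bessel_struve_coef nu n) * z ^+ n)).

Definition unit_disk (R : realType) : set (Cplx R) := [set z | `|z| < 1].

(* On an open set, analyticity is complex differentiability at every point. *)
Definition analytic_on (R : realType) (D : set (Cplx R))
    (f : Cplx R -> Cplx R) : Prop :=
  forall z, D z -> derivable f z 1.

(* Functions on the disk are represented by total functions, of which only the
   values on the disk matter. *)
Definition class_A (R : realType) (f : Cplx R -> Cplx R) : Prop :=
  [/\ analytic_on (@unit_disk R) f,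
      {in @unit_disk R &, injective f},
      f 0 = 0
    & f^`()%classic 0 = 1].

Definition T_quotient (R : realType) (lambda : R) (f : Cplx R -> Cplx R)
    (z : Cplx R) : Cplx R :=
  if z == 0 then 1 else
  (z * f^`()%classic z + RtoC lambda * z ^+ 2 * f^`(2)%classic z) /
  ((1 - RtoC lambda) * f z + RtoC lambda * z * f^`()%classic z).

(* Used for 0 <= alpha: a zero of the denominator at z != 0 makes
   [T_quotient lambda f z] equal to 0, hence excludes f from the class. *)
Definition class_T (R : realType) (lambda alpha : R) (f : Cplx R -> Cplx R) :
    Prop :=
  class_A f /\
  forall z, unit_disk z -> alpha < complex.Re (T_quotient lambda f z).

(* Main.v *)
From HB Require Import structures.
Require Import Defs.
From mathcomp Require Import measurable_realfun ring lra.

(* Write S_nu(z) = \sum_n c_n z^n.  Euler's integral gives c_0 = 1 (through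
   Gamma(1/2) = sqrt pi), c_n >= 0 and c_n = O(1/n!), so S_nu is entire and may
   be differentiated termwise.  The hypothesis at z = 1 then reads
     \sum_(n >= 1) (n + 1 - alpha) (lambda n + 1) c_n <= 1 - alpha,
   since the n = 0 term of the full sum is 1 - alpha.
   Univalence: (n + 1) (1 - alpha) <= (n + 1 - alpha) (lambda n + 1), so that
   f(z) - z is Lipschitz with constant r < 1 on the disk of radius r.
   Membership in T_lambda(alpha): with B_n = (1 + lambda n) c_n the quotient is
   \sum (n + 1) B_n z^n / \sum B_n z^n, and
     |\sum n B_n z^n| + (1 - alpha) |\sum B_n z^n - 1| <= (1 - alpha) |z|
   places it within distance less than 1 - alpha of 1. *)

Set Implicit Arguments.
Unset Strict Implicit.
Unset Printing Implicit Defensive.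

Local Open Scope classical_set_scope.
Local Open Scope ring_scope.

(** * Power series over the complex numbers *)

Lemma is_derive_cvg (K : numFieldType) (V W : normedModType K)
    (f : V -> W) (a v : V) (l : W) :
  h^-1 *: (f (h *: v + a) - f a) @[h --> (0 : K)^'] --> l -> is_derive a v f l.
Proof.
move=> fl; split; first by apply/cvg_ex; exists l.
by rewrite /derive; apply/cvg_lim => //; exact: fl.
Qed.

Lemma cvg_series_behead (K : numFieldType) (v : nat -> K) (l : K) :
  series v @ \oo --> l ->
  series (fun n => v n.+1) @ \oo --> l - v 0%N.
Proof.
rewrite -(cvg_shiftS (series v)) => vl.
rewrite (_ : series _ = fun n => series v n.+1 - v 0%N).
  by apply: cvgB => //; exact: cvg_cst.
by apply/funext => n; rewrite /series/= big_nat_recl// addrC addrA addNr add0r.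
Qed.

Section ComplexSeries.
Variable R : realType.
Notation C := (Cplx R).
Implicit Types (z w : C) (x y : R) (u v : nat -> R).

(** * Embedding of the reals, real modulus and comparison of series *)

Lemma RtoC_is_zmod_morphism : zmod_morphism (@RtoC R : R -> Cplx R).
Proof. exact: (rmorphB (real_complex R)). Qed.

Lemma RtoC_is_monoid_morphism : monoid_morphism (@RtoC R : R -> Cplx R).
Proof.
by split; [exact: (rmorph1 (real_complex R))|exact: (rmorphM (real_complex R))].
Qed.

HB.instance Definition _ := GRing.isZmodMorphism.Build R (Cplx R) (@RtoC R)
  RtoC_is_zmod_morphism.
HB.instance Definition _ := GRing.isMonoidMorphism.Build R (Cplx R) (@RtoC R)
  RtoC_is_monoid_morphism.

(** The norm on [Cplx R] is itself complex-valued; this real version lets estimates be carried out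
    in the ordered field [R]. *)
Definition cabs z : R := complex.Re (`|z| : R[i]).

Lemma ler_RtoC x y : (RtoC x <= RtoC y) = (x <= y).
Proof. exact: lecR. Qed.

Lemma ltr_RtoC x y : (RtoC x < RtoC y) = (x < y).
Proof. exact: ltcR. Qed.

Lemma normcRE z : `|z| = RtoC (cabs z).
Proof. by rewrite /cabs -[`|z|]/(`|z : R[i]|) normc_def. Qed.

Lemma norm_RtoC x : `|RtoC x| = RtoC `|x|.
Proof.
by rewrite -[LHS]/(`|x%:C%C : R[i]|) normc_def /= expr0n addr0 sqrtr_sqr.
Qed.

Lemma RtoC_inj : injective (@RtoC R).
Proof. exact: fmorph_inj. Qed.

Lemma Re_le_cabs z : `|complex.Re z| <= cabs z.
Proof. by rewrite -ler_RtoC -normcRE; exact: normc_ge_Re. Qed.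

Lemma Im_le_cabs z : `|complex.Im z| <= cabs z.
Proof.
rewrite /cabs normc_def /= -sqrtr_sqr ler_wsqrtr //.
by rewrite lerDr sqr_ge0.
Qed.

Lemma cplxE z : z = RtoC (complex.Re z) + 'i * RtoC (complex.Im z).
Proof. exact: complexE. Qed.

(** The order on complex numbers is partial and compares only equal imaginary parts, so every
    complex epsilon is a real one. *)
Lemma Cplx_gt0 (e : C) : 0 < e -> exists2 x, e = RtoC x & 0 < x.
Proof.
case: e => a b; rewrite -[0]/(RtoC 0) => /[dup] h.
rewrite -[(_ < _)%R]/((b == 0) && (0 < a)) => /andP[/eqP -> a0].
by exists a.
Qed.

Lemma continuous_RtoC : continuous (@RtoC R).
Proof.
move=> x; apply/cvgrPdist_lt => e /Cplx_gt0[d -> d0]; near=> y.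
rewrite -rmorphB norm_RtoC ltr_RtoC.
near: y; exact: cvgr_dist_lt.
Unshelve. all: by end_near. Qed.

(* [complex.Re] retyped on [Cplx R], so that the topology of its domain is
   inferred. *)
Definition ReC (z : C) : R := complex.Re z.

Lemma continuous_Re : continuous ReC.
Proof.
move=> x; have FF : Filter (nbhs x) by exact: nbhs_filter.
apply/(@cvgrPdist_lt _ _ _ _ FF) => e e0.
have e0' : 0 < RtoC e by rewrite -[0]/(RtoC 0) ltr_RtoC.
near=> y; rewrite /ReC -raddfB; apply: le_lt_trans (Re_le_cabs _) _.
rewrite -ltr_RtoC -normcRE.
near: y; exact: (@cvgr_dist_lt _ _ _ _ FF id x (fun _ h => h) _ e0').
Unshelve. all: by end_near. Qed.

(** The real and imaginary parts are dominated by [w], hence converge absolutely; they recombine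
    through Re + i Im. *)
Lemma is_cvg_cseries (u : nat -> C) (w : nat -> R) :
  (forall n, `|u n| <= RtoC (w n)) -> cvgn (series w) -> cvgn (series u).
Proof.
move=> uw cw.
have real_cvg (v : nat -> R) : (forall n, `|v n| <= w n) -> cvgn (series v).
  move=> vw; apply: normed_cvg; apply: (series_le_cvg _ _ _ cw) => // n.
    exact: normr_ge0.
  exact: le_trans (vw n).
have cRe : cvgn (series (fun n => complex.Re (u n))).
  by apply: real_cvg => n; rewrite (le_trans (Re_le_cabs _))//
    -ler_RtoC -normcRE.
have cIm : cvgn (series (fun n => complex.Im (u n))).
  by apply: real_cvg => n; rewrite (le_trans (Im_le_cabs _))//
    -ler_RtoC -normcRE.
have -> : series u = (fun n => RtoC (series (fun n => complex.Re (u n)) n)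
    + 'i * RtoC (series (fun n => complex.Im (u n)) n)).
  apply/funext => n; rewrite /series/= !rmorph_sum mulr_sumr -big_split/=.
  by apply: eq_bigr => k _; exact: cplxE.
apply: is_cvgD.
  by apply: (cvgP (RtoC (limn (series (fun n => complex.Re (u n))))));
    apply: (cvg_comp _ _ cRe); exact: continuous_RtoC.
apply: is_cvgM; first exact: is_cvg_cst.
by apply: (cvgP (RtoC (limn (series (fun n => complex.Im (u n))))));
  apply: (cvg_comp _ _ cIm); exact: continuous_RtoC.
Qed.

Lemma norm_lim_le (u : nat -> C) (l b : C) : (forall n, `|u n| <= b) ->
  u @ \oo --> l -> `|l| <= b.
Proof.
move=> ub ul.
have b0 : 0 <= b by exact: le_trans (normr_ge0 _) (ub 0%N).
(* Arguing by contradiction in a partial order requires both sides to be real; [b] is, being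
   nonnegative. *)
rewrite real_leNgt ?normr_real ?ger0_real//; apply/negP => bl.
have e0 : 0 < `|l| - b by rewrite subr_gt0.
have [N _ /(_ N (leqnn N)) /=] := @cvgr_dist_lt _ _ _ _ _ u l ul _ e0.
rewrite ltrBrDr => h; suff : `|l| < `|l| by rewrite ltxx.
apply: le_lt_trans h; rewrite -[X in `|X| <= _](subrK (u N)).
rewrite (le_trans (ler_normD _ _))// lerD2l.
exact: ub.
Qed.

Lemma norm_lim_series_le (v : nat -> C) (w : nat -> R) (l : C) b :
  (forall n, `|v n| <= RtoC (w n)) -> (forall n, series w n <= b) ->
  series v @ \oo --> l -> `|l| <= RtoC b.
Proof.
move=> vw wb; apply: norm_lim_le => n.
rewrite (le_trans (ler_norm_sum _ _ _))//.
rewrite (le_trans (ler_sum _ (fun k _ => vw k)))// -rmorph_sum ler_RtoC.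
exact: wb.
Qed.

(** On coefficient sequences this is multiplication by z. *)
Definition cons0 (V : zmodType) (v : nat -> V) (n : nat) : V :=
  if n is m.+1 then v m else 0.

Lemma series_cons0 (V : zmodType) (v : nat -> V) n :
  series (cons0 v) n.+1 = series v n.
Proof. by rewrite /series/= big_nat_recl//= add0r. Qed.

Lemma cvg_series_cons0 (v : nat -> C) (l : C) : series v @ \oo --> l ->
  series (cons0 v) @ \oo --> l.
Proof.
move=> vl; rewrite -(cvg_shiftS (series (cons0 v))).
by under eq_fun do rewrite series_cons0.
Qed.

(* Equivalent to an infinite radius of convergence, and visibly stable under
   the operations below. *)
Definition entire u := forall r, 0 <= r ->
  exists K, forall n, `|u n| * r ^+ n <= K.

Definition psum u z : C := limn (series (fun n => RtoC (u n) * z ^+ n)).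

Lemma entire_is_cvg u r : entire u -> 0 <= r ->
  cvgn (series (fun n => `|u n| * r ^+ n)).
Proof.
(* A bound at radius 2r makes the terms at radius r at most K / 2^n. *)
move=> eu r0; have [K uK] := eu (2 * r) ltac:(by rewrite mulr_ge0).
have K0 : 0 <= K by apply: le_trans (uK 0%N); rewrite mulr_ge0.
apply: (@series_le_cvg _ _ (geometric K 2^-1)).
- by move=> n; rewrite mulr_ge0// exprn_ge0.
- by move=> n; rewrite /geometric/= mulr_ge0.
- move=> n; rewrite /geometric/= exprVn ler_pdivlMr ?exprn_gt0//.
  by rewrite -mulrA -exprMn [r * 2]mulrC.
by apply: is_cvg_geometric_series; rewrite ger0_norm// invf_lt1// ltr1n.
Qed.

Lemma series_bounded u r : entire u -> 0 <= r ->
  exists B, forall n, series (fun n => `|u n| * r ^+ n) n <= B.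
Proof.
move=> eu r0; exists (limn (series (fun n => `|u n| * r ^+ n))) => n.
apply: nondecreasing_cvgn_le; last exact: entire_is_cvg.
by apply: nondecreasing_series => k _; rewrite mulr_ge0// exprn_ge0.
Qed.

Lemma psum_term_norm u z n :
  `|RtoC (u n) * z ^+ n| = RtoC (`|u n| * cabs z ^+ n).
Proof. by rewrite normrM norm_RtoC normrX normcRE rmorphM rmorphXn. Qed.

Lemma cabs_ge0 z : 0 <= cabs z.
Proof. by rewrite -ler_RtoC -normcRE rmorph0. Qed.

Lemma psum_cvg u z : entire u ->
  series (fun n => RtoC (u n) * z ^+ n) @ \oo --> psum u z.
Proof.
move=> eu; apply: is_cvg_cseries (entire_is_cvg eu (cabs_ge0 z)).
by move=> n; rewrite psum_term_norm.
Qed.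

(** Doubling the radius pays for the factor, since n <= 2^n. *)
Lemma entireM_nat u : entire u -> entire (fun n => n%:R * u n).
Proof.
move=> eu r r0; have [K uK] := eu (2 * r) ltac:(by rewrite mulr_ge0).
exists K => n; apply: le_trans (uK n).
rewrite exprMn normrM normr_nat mulrA ler_wpM2r ?exprn_ge0// mulrC ler_wpM2l//.
rewrite -natrX ler_nat; exact/ltnW/ltn_expl.
Qed.

Lemma entire_lin a b u v : entire u -> entire v ->
  entire (fun n => a * u n + b * v n).
Proof.
move=> eu ev r r0; have [K uK] := eu r r0; have [L vL] := ev r r0.
exists (`|a| * K + `|b| * L) => n.
rewrite (@le_trans _ _ (`|a| * (`|u n| * r ^+ n) + `|b| * (`|v n| * r ^+ n)))//.
  rewrite !mulrA -mulrDl ler_wpM2r ?exprn_ge0//.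
  by rewrite (le_trans (ler_normD _ _))// !normrM.
by rewrite lerD// ler_wpM2l.
Qed.

Lemma entire_cons0 u : entire u -> entire (cons0 u).
Proof.
move=> eu r r0; have [K uK] := eu r r0.
have K0 : 0 <= K by apply: le_trans (uK 0%N); rewrite mulr_ge0.
exists (K * r) => -[|n]/=; first by rewrite normr0 mul0r mulr_ge0.
by rewrite exprSr mulrA ler_wpM2r.
Qed.

Lemma entire_behead u : entire u -> entire (fun n => u n.+1).
Proof.
(* Radius r + 1 is at least 1, so the extra power gained by the index shift does no harm: r^n <= (r
   + 1)^(n + 1). *)
move=> eu r r0; have [K uK] := eu (r + 1) ltac:(by rewrite addr_ge0).
exists K => n; apply: le_trans (uK n.+1).
rewrite ler_wpM2l// (@le_trans _ _ ((r + 1) ^+ n))//.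
  by rewrite lerXn2r ?nnegrE ?addr_ge0// lerDl.
by apply: ler_weXn2l; rewrite ?lerDr.
Qed.

Lemma entire_diffs u : entire u -> entire (pseries_diffs u).
Proof. by move=> /entireM_nat/entire_behead. Qed.

Lemma psum_lin a b u v z : entire u -> entire v ->
  psum (fun n => a * u n + b * v n) z = RtoC a * psum u z + RtoC b * psum v z.
Proof.
move=> eu ev; apply/cvg_lim => //.
rewrite (_ : series _ =
  (fun n => RtoC a * series (fun n => RtoC (u n) * z ^+ n) n
   + RtoC b * series (fun n => RtoC (v n) * z ^+ n) n)).
  apply: cvgD; apply: cvgM; try exact: cvg_cst; exact: psum_cvg.
apply/funext => n; rewrite /series/= !mulr_sumr -big_split/=;
  apply: eq_bigr => k _.
by rewrite rmorphD !rmorphM mulrDl !mulrA.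
Qed.

Lemma psum_cons0 u z : entire u -> psum (cons0 u) z = z * psum u z.
Proof.
move=> eu; apply/cvg_lim => //.
rewrite (_ : (fun n => _) = cons0 (fun n => z * (RtoC (u n) * z ^+ n)));
  last first.
  by apply/funext => -[|n]/=; rewrite ?rmorph0 ?mul0r// exprS mulrCA.
apply: cvg_series_cons0.
rewrite (_ : series _ = (fun n => z * series (fun n => RtoC (u n) * z ^+ n) n)).
  by apply: cvgM; [exact: cvg_cst|exact: psum_cvg].
by apply/funext => n; rewrite /series/= mulr_sumr.
Qed.

(** * Termwise differentiation of entire power series *)

Lemma psum_diffs u z : entire u ->
  z * psum (pseries_diffs u) z = psum (fun n => n%:R * u n) z.
Proof.
move=> eu; rewrite -psum_cons0; last exact: entire_diffs.
by congr psum; apply/funext => -[|n]//=; rewrite mul0r.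
Qed.

(** Induction: the remainder at n + 1 is (z + h) times the one at n, plus n h^2 z^(n-1), and n^2 + n
    <= (n + 1)^2. The bound 1 <= r allows raising powers of r. *)
Lemma expr_second_order (z h : C) (r : C) n : 1 <= r -> `|z| <= r ->
  `|z + h| <= r ->
  `|(z + h) ^+ n - z ^+ n - n%:R * h * z ^+ n.-1| <=
    n%:R ^+ 2 * r ^+ n * `|h| ^+ 2.
Proof.
move=> r1 zr zhr; have r0 : 0 <= r by rewrite (le_trans _ r1).
elim: n => [|n IH]; first by rewrite !expr0 subrr !mul0r expr0n !mul0r sub0r
  oppr0 normr0.
have -> : (z + h) ^+ n.+1 - z ^+ n.+1 - n.+1%:R * h * z ^+ n.+1.-1 =
  (z + h) * ((z + h) ^+ n - z ^+ n - n%:R * h * z ^+ n.-1)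
    + n%:R * h ^+ 2 * z ^+ n.-1.
  case: n IH => [_|n _]/=; first by rewrite !expr0 expr1; ring.
  by rewrite !exprS -!natr1; ring.
rewrite (le_trans (ler_normD _ _))//.
rewrite (@le_trans _ _ (n%:R ^+ 2 * r ^+ n.+1 * `|h| ^+ 2
  + n%:R * r ^+ n.+1 * `|h| ^+ 2))//.
  apply: lerD.
    rewrite normrM (le_trans (ler_pM _ _ zhr IH))//.
    by rewrite le_eqVlt; apply/orP; left; apply/eqP; rewrite [r ^+ n.+1]exprS;
      ring.
  rewrite !normrM normr_nat !normrX mulrAC ler_wpM2r ?exprn_ge0// ler_wpM2l//.
  rewrite (@le_trans _ _ (r ^+ n.-1))//; first by rewrite lerXn2r// nnegrE.
  by rewrite ler_weXn2l// leqW// leq_pred.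
rewrite -!mulrDl ler_wpM2r ?exprn_ge0// ler_wpM2r ?exprn_ge0//.
by rewrite -natrX -natrD -natrX ler_nat addnC -!mulnn -mulnS leq_mul.
Qed.

Lemma psum_remainder u z : entire u -> exists M : R, forall h, `|h| <= 1 ->
  `|psum u (z + h) - psum u z - h * psum (pseries_diffs u) z| <=
    RtoC M * `|h| ^+ 2.
Proof.
(* This radius covers z and every z + h with |h| <= 1; the constant is then a bound on the partial
   sums of n^2 |u_n| r^n. *)
move=> eu; pose r := cabs z + 1.
have r0 : 0 <= r by rewrite addr_ge0 ?cabs_ge0.
have e2 := entireM_nat (entireM_nat eu).
have [B hB] := series_bounded e2 r0.
exists B => h h1.
have [d hd d0] : exists2 d, `|h| = RtoC d & 0 <= d.
  by exists (cabs h); [exact: normcRE|exact: cabs_ge0].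
rewrite hd -rmorphXn -rmorphM.
pose v n := RtoC (u n) * ((z + h) ^+ n - z ^+ n - n%:R * h * z ^+ n.-1).
apply: (@norm_lim_series_le v (fun n =>
  `|n%:R * (n%:R * u n)| * r ^+ n * d ^+ 2)).
- move=> n; rewrite /v normrM norm_RtoC.
  rewrite (@le_trans _ _
    (RtoC `|u n| * (n%:R ^+ 2 * RtoC r ^+ n * `|h| ^+ 2)))//.
    apply: ler_wpM2l; first by rewrite -(rmorph0 (@RtoC R)) ler_RtoC.
    apply: expr_second_order.
    + by rewrite -(rmorph1 (@RtoC R)) ler_RtoC lerDr cabs_ge0.
    + by rewrite normcRE ler_RtoC lerDl.
    + have -> : RtoC r = `|z| + 1.
        by rewrite normcRE -[1 in RHS](rmorph1 (@RtoC R)) -rmorphD.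
      by rewrite (le_trans (ler_normD _ _))// lerD2l.
  rewrite hd (_ : _ * _ = RtoC (`|u n| * (n%:R ^+ 2 * r ^+ n * d ^+ 2))).
    rewrite ler_RtoC !normrM normr_nat le_eqVlt; apply/orP; left; apply/eqP;
      ring.
  by rewrite !rmorphM !rmorphXn rmorph_nat.
- move=> n; rewrite /series/= -mulr_suml ler_wpM2r ?exprn_ge0//; exact: hB.
rewrite (_ : series v = fun n => series (fun n => RtoC (u n) * (z + h) ^+ n) n
    - series (fun n => RtoC (u n) * z ^+ n) n
    (* The shift by [cons0] puts n u_n z^(n-1) at index n, in line with the other two series. *)
    - h * series (cons0 (fun n => RtoC (pseries_diffs u n) * z ^+ n)) n).
  apply: cvgB; first by apply: cvgB; exact: psum_cvg.
  apply: cvgM; first exact: cvg_cst.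
  by apply: cvg_series_cons0; apply: psum_cvg; exact: entire_diffs.
apply/funext => n; rewrite /series/= mulr_sumr -!sumrB; apply: eq_bigr => k _.
rewrite /v; case: k => [|k]/=; first by ring.
by rewrite /pseries_diffs rmorphM rmorph_nat; ring.
Qed.

Lemma is_derive_psum u z : entire u ->
  is_derive z (1 : C) (psum u) (psum (pseries_diffs u) z).
Proof.
move=> eu; have [M hM] := psum_remainder z eu.
have M0 : 0 <= M.
  have := hM 1; rewrite normr1 expr1n mulr1 => /(_ (lexx _)).
  by move=> /(le_trans (normr_ge0 _)); rewrite -(rmorph0 (@RtoC R)) ler_RtoC.
have cv : h^-1 *: (psum u (h *: (1 : C) + z) - psum u z) @[h --> 0^']
    --> psum (pseries_diffs u) z.
  have FF : Filter ((0 : C)^') by exact: dnbhs_filter.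
  apply/(@cvgrPdist_le _ _ _ _ FF) => e /Cplx_gt0[d -> d0].
  (* The 1 keeps h in the range of the quadratic bound; M + 1 in place of M covers M = 0. *)
  have d1 : 0 < Num.min 1 (d / (M + 1)).
    by rewrite lt_min ltr01 divr_gt0// ltr_wpDl.
  near=> h.
  have h0 : h != 0 by near: h; exact: nbhs_dnbhs_neq.
  have hd : `|h| < RtoC (Num.min 1 (d / (M + 1))).
    by near: h; apply: dnbhs0_lt; rewrite -(rmorph0 (@RtoC R)) ltr_RtoC.
  have [hh hhE] : exists hh, `|h| = RtoC hh by exists (cabs h); exact: normcRE.
  have hh0 : 0 < hh by rewrite -ltr_RtoC rmorph0 -hhE normr_gt0.
  move: hd; rewrite hhE ltr_RtoC lt_min => /andP[hh1 hhd].
  have := hM h; rewrite hhE -(rmorph1 (@RtoC R)) ler_RtoC => /(_ (ltW hh1)) H.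
  rewrite -[X in h *: X]/(1 : C) [h *: 1]mulr1 [h + z]addrC.
  rewrite distrC -(ler_pM2l (_ : 0 < `|h|)) ?normr_gt0//
    -normrM mulrBr mulrA mulfV// mul1r.
  rewrite (le_trans H)// hhE -rmorphXn -!rmorphM ler_RtoC.
  rewrite expr2 mulrCA ler_wpM2l ?ltW//.
  move: hhd; rewrite ltr_pdivlMr ?ltr_wpDl//; nra.
exact: is_derive_cvg cv.
Unshelve. all: by end_near. Qed.

Lemma derive1_psum u : entire u ->
  (psum u)^`()%classic = psum (pseries_diffs u).
Proof.
move=> eu; apply/funext => z; rewrite derive1E.
by have [_ ->] := is_derive_psum z eu.
Qed.

Lemma cabsM z w : cabs (z * w) = cabs z * cabs w.
Proof. by apply: RtoC_inj; rewrite rmorphM -!normcRE normrM. Qed.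

Lemma cabs1 : cabs (1 : C) = 1.
Proof. by apply: RtoC_inj; rewrite -normcRE normr1 rmorph1. Qed.

Lemma cabsX z n : cabs (z ^+ n) = cabs z ^+ n.
Proof. by elim: n => [|n IHn]; rewrite ?expr0 ?cabs1// !exprS cabsM IHn. Qed.

Lemma ler_cabsD z w : cabs (z + w) <= cabs z + cabs w.
Proof. by rewrite -ler_RtoC rmorphD -!normcRE ler_normD. Qed.

Lemma ler_cabs_series (v : nat -> C) n :
  cabs (series v n) <= \sum_(0 <= k < n) cabs (v k).
Proof.
elim: n => [|n IHn]; first by rewrite /series/= !big_geq// /cabs normr0.
rewrite /series/= !big_nat_recr//= (le_trans (ler_cabsD _ _))// lerD2r.
exact: IHn.
Qed.

Lemma cabs0_eq0 z : cabs z = 0 -> z = 0.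
Proof. by move=> z0; apply/eqP; rewrite -normr_eq0 normcRE z0 rmorph0. Qed.

Lemma cabs_unit_disk z : unit_disk z -> cabs z < 1.
Proof. by rewrite /unit_disk/= normcRE -(rmorph1 (@RtoC R)) ltr_RtoC. Qed.

Lemma psum0 u : entire u -> psum u 0 = RtoC (u 0%N).
Proof.
move=> eu; apply/cvg_lim => //.
rewrite -(cvg_shiftS (series _)).
rewrite (_ : (fun n => _) = fun=> RtoC (u 0%N)); first exact: cvg_cst.
apply/funext => n; rewrite /series/= big_nat_recl// expr0 mulr1.
rewrite big1 ?addr0// => i _.
by rewrite exprS mul0r mulr0.
Qed.

(** Turns an inequality on the value at z = 1 into one on all partial sums: these increase to the
    real part of that value. *)
Lemma series_le_Re_psum u N : entire u -> (forall n, 0 <= u n) ->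
  series u N <= complex.Re (psum u 1).
Proof.
move=> eu u0; have cu := psum_cvg (z := (1 : C)) eu.
have {}cu : series u @ \oo --> ReC (psum u 1).
  rewrite (_ : series u =
    fun n => ReC (series (fun k => RtoC (u k) * (1 : C) ^+ k) n)).
    by apply: (cvg_comp _ _ cu); exact: continuous_Re.
  apply/funext => n; rewrite /series/=.
  rewrite (_ : \sum_(_ <= _ < _) _ = RtoC (series u n))//.
  by rewrite rmorph_sum; apply: eq_bigr => k _; rewrite expr1n mulr1.
rewrite -/(ReC _) -(cvg_lim _ cu)//; apply: nondecreasing_cvgn_le;
  last exact: cvgP cu.
exact: nondecreasing_series.
Qed.

Lemma entire_le_fact u K : 0 <= K -> (forall n, `|u n| <= K / n`!%:R) ->
  entire u.
Proof.
move=> K0 uK r r0; exists (K * expR r) => n.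
rewrite (@le_trans _ _ (K / n`!%:R * r ^+ n))//;
  first by rewrite ler_wpM2r ?exprn_ge0.
rewrite -mulrA ler_wpM2l// mulrC.
(* [expR_ge1Dxn] bounds r^(n+1) / (n+1)! by e^r; index 0 is treated apart. *)
case: n => [|n].
  by rewrite expr0 mul1r fact0 invr1 (le_trans _ (expR_ge1Dx r))// lerDl.
by rewrite (le_trans _ (expR_ge1Dxn n r0))// lerDr.
Qed.

Lemma ler_cabs_subX z w r n : cabs z <= r -> cabs w <= r ->
  cabs (z ^+ n.+1 - w ^+ n.+1) <= n.+1%:R * r ^+ n * cabs (z - w).
Proof.
move=> zr wr; have r0 : 0 <= r by exact: le_trans (cabs_ge0 z) zr.
elim: n => [|n IH]; first by rewrite !expr1 expr0 !mul1r.
have -> : z ^+ n.+2 - w ^+ n.+2 =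
    z * (z ^+ n.+1 - w ^+ n.+1) + w ^+ n.+1 * (z - w).
  by rewrite (exprS z n.+1) (exprS w n.+1); ring.
rewrite (le_trans (ler_cabsD _ _))// !cabsM.
rewrite (@le_trans _ _ (r * (n.+1%:R * r ^+ n * cabs (z - w))
  + r ^+ n.+1 * cabs (z - w)))//.
  apply: lerD; first by rewrite ler_pM ?cabs_ge0.
  by rewrite ler_wpM2r ?cabs_ge0// cabsX lerXn2r// nnegrE cabs_ge0.
by rewrite le_eqVlt; apply/orP; left; apply/eqP;
  rewrite -(natr1 n.+1) (exprS r n); ring.
Qed.

Lemma entireM_nat2 u : entire u -> entire (fun n => n%:R * (n%:R - 1) * u n).
Proof.
move=> /entireM_nat e1.
have := entire_lin 1 (-1) (entireM_nat e1) e1; congr entire.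
by apply/funext => n; ring.
Qed.

Lemma psum_diffs2 u z : entire u ->
  z ^+ 2 * psum (pseries_diffs (pseries_diffs u)) z =
  psum (fun n => n%:R * (n%:R - 1) * u n) z.
Proof.
move=> eu; have ed := entire_diffs eu.
rewrite expr2 -mulrA psum_diffs// -psum_cons0; last exact: entireM_nat.
congr psum; apply/funext => -[|n]/=; first by rewrite mul0r mul0r.
by rewrite /pseries_diffs -natr1; ring.
Qed.

End ComplexSeries.

(** The two limits are bounded jointly, since separate bounds would lose the constraint on their
    weighted sum. *)
Lemma norm_lim2_le (R : realType) (u v : nat -> Cplx R) (k b : R)
    (l m : Cplx R) : 0 <= k ->
  (forall n, cabs (u n) + k * cabs (v n) <= b) ->
  u @ \oo --> l -> v @ \oo --> m ->
  cabs l + k * cabs m <= b.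
Proof.
move=> k0 uvb ul vm.
have nneg (z w : Cplx R) :
    `| `|z| + RtoC k * `|w| | = RtoC (cabs z + k * cabs w).
  rewrite (normcRE z) (normcRE w) -rmorphM -rmorphD norm_RtoC ger0_norm//.
  by rewrite addr_ge0 ?mulr_ge0 ?cabs_ge0.
have H : (fun n => `|u n| + RtoC k * `|v n| : Cplx R) @ \oo
    --> (`|l| + RtoC k * `|m| : Cplx R).
  exact: (cvgD (cvg_norm ul) (cvgM (cvg_cst (RtoC k)) (cvg_norm vm))).
rewrite -ler_RtoC -nneg.
apply: (@norm_lim_le _ _ _ (RtoC b) _ H) => n.
by rewrite nneg ler_RtoC.
Qed.

(** * Euler's integral and the Bessel-Struve coefficients *)

Section GammaFunction.
Variable R : realType.
Notation mu := (@lebesgue_measure R).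
Implicit Types x y t : R.

Let g x t : R := t `^ (x - 1) * expR (- t).

Lemma gamma_integrand_ge0 x t : 0 <= g x t.
Proof. by rewrite mulr_ge0 ?powR_ge0 ?expR_ge0. Qed.

Lemma measurable_gamma_integrand x (D : set R) :
  measurable_fun D (fun t => (g x t)%:E).
Proof.
apply/measurable_EFinP; apply: measurable_funTS; apply: measurable_funM.
  exact: measurable_powR.
by apply: measurableT_comp => //; exact: measurableT_comp.
Qed.

(** * The value Gamma(1/2) = sqrt pi *)

Lemma bigcup_itvcy (e : nat -> R) : (forall n, 0 < e n) ->
  (forall x, 0 < x -> exists n, e n <= x) ->
  \bigcup_n `[e n, +oo[%classic = `]0, +oo[%classic.
Proof.
move=> e0 ex; apply/seteqP; split => x/=.
  by move=> [n _]/=; rewrite !in_itv/= !andbT; exact: lt_le_trans.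
by rewrite in_itv/= andbT => /ex[n nx]; exists n; rewrite //= in_itv/= andbT.
Qed.

Lemma cvg_integral_itvcy (e : nat -> R) (f : R -> \bar R) :
  (forall n, 0 < e n) ->
  (forall x, 0 < x -> exists n, e n <= x) -> nonincreasing_seq e ->
  measurable_fun setT f -> (forall x, (0 <= f x)%E) ->
  (\int[mu]_(x in `[e n, +oo[) f x @[n --> \oo] -->
   \int[mu]_(x in `]0%R, +oo[) f x)%E.
Proof.
move=> e0 ex ne mf f0; rewrite -(bigcup_itvcy e0 ex).
apply: ge0_nondecreasing_set_cvg_integral => //.
- move=> m n mn; rewrite subsetEset => x/=; rewrite !in_itv/= !andbT.
  exact: le_trans (ne _ _ mn).
- by move=> i; exact: measurable_funTS.
Qed.

Lemma sqrt_cvgy : Num.sqrt x @[x --> +oo] --> (+oo : set_system R).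
Proof.
apply/cvgryPge => A; near=> x.
rewrite (le_trans (ler_norm A))// -sqrtr_sqr ler_wsqrtr//.
Unshelve. all: by end_near. Qed.

(** Substituting x = sqrt t turns e^(-x^2) into e^(-t), and the Jacobian 1 / (2 sqrt t) supplies
    both the power t^(1/2 - 1) and the factor 1/2. *)
Lemma integral_gauss_sqrt (e : R) : 0 < e ->
  (\int[mu]_(x in `[Num.sqrt e, +oo[) (gauss_fun x)%:E =
   \int[mu]_(x in `[e, +oo[) (2^-1 * g 2^-1 x)%:E)%E.
Proof.
move=> e0.
pose D : R -> R := (@Num.sqrt R)^`()%classic.
have dE x : 0 < x -> D x = (2 * Num.sqrt x)^-1.
  by move=> x0; rewrite /D derive1E derive_sqrt.
have cinv x : 0 < x -> {for x, continuous (fun y => (2 * Num.sqrt y)^-1 : R)}.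
  move=> x0; apply: continuousV; first by rewrite mulf_neq0// sqrtr_eq0 -ltNge.
  by apply: continuousM; [exact: cst_continuous|exact: sqrt_continuous].
have cdE x : 0 < x -> {for x, continuous D}.
  move=> x0; change (D y @[y --> x] --> D x); rewrite dE//.
  apply: cvg_trans (cinv x x0); apply: near_eq_cvg.
  near=> y; rewrite dE//; near: y; exact: lt_nbhsr.
rewrite (@increasing_ge0_integration_by_substitutiony _ Num.sqrt)//;
  rewrite -?/D.
- apply: eq_integral => x; rewrite inE/= in_itv/= andbT => ex.
  have x0 : 0 < x := lt_le_trans e0 ex.
  congr EFin; change (gauss_fun (Num.sqrt x) * D x = 2^-1 * g 2^-1 x).
  rewrite dE// /gauss_fun sqr_sqrtr ?ltW// /g.
  rewrite (_ : 2^-1 - 1 = - 2^-1); last by field.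
  by rewrite powRN powR12_sqrt ?ltW// invfM mulrC mulrA.
- move=> x y; rewrite !in_itv/= !andbT => ex ey xy.
  by rewrite ltr_sqrt// (lt_le_trans e0).
- by move=> x; rewrite in_itv/= andbT => ex; apply: cdE; exact: lt_trans ex.
- by apply/cvg_ex; exists (D e); apply: cvg_at_right_filter; exact: cdE.
- apply/cvg_ex; exists 0.
  apply: (@cvg_trans _ ((2 * Num.sqrt x)^-1 @[x --> +oo])).
    by apply: near_eq_cvg; near=> x; rewrite dE//; near: x;
      exact: nbhs_pinfty_gt.
  apply: (iffRL (gtr0_cvgV0 (f := fun x : R => 2 * Num.sqrt x) _)).
    by near=> x; rewrite mulr_gt0// sqrtr_gt0; near: x; exact: nbhs_pinfty_gt.
  apply: gt0_cvgMry => //; exact: sqrt_cvgy.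
- split; last by apply: cvg_at_right_filter; exact: sqrt_continuous.
  by move=> x; rewrite in_itv/= andbT => ex; apply: ex_derive;
    apply: is_derive1_sqrt; exact: lt_trans ex.
- exact: sqrt_cvgy.
- by apply: continuous_subspaceT; exact: continuous_gauss_fun.
- by move=> x _; exact: gauss_fun_ge0.
Unshelve. all: by end_near. Qed.

(* The substitution t = x^2 in the Gauss integral, on [e, +oo[ because the
   derivative of sqrt is unbounded at 0, and then e --> 0. *)
Lemma integral_gamma_half :
  (\int[mu]_(x in `]0%R, +oo[) (g 2^-1 x)%:E)%E = (Num.sqrt pi)%:E.
Proof.
(* Cutoffs [d n] on the Gauss side match [e n] on the Gamma side, because sqrt (e n) = d n. *)
pose d n : R := n.+1%:R^-1; pose e n : R := d n ^+ 2.
have d0 n : 0 < d n by rewrite invr_gt0.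
have e0 n : 0 < e n by rewrite exprn_gt0.
have nd : nonincreasing_seq d.
  by move=> m n mn; rewrite lef_pV2 ?posrE// ler_nat.
have ne : nonincreasing_seq e.
  by move=> m n mn; rewrite lerXn2r ?nnegrE ?(ltW (d0 _))//; exact: nd.
have dx x : 0 < x -> exists n, d n <= x.
  by move=> x0; have [n] := ltr_add_invr x0; rewrite add0r => /ltW nx; exists n.
have ex x : 0 < x -> exists n, e n <= x.
  move=> x0; have sx0 : 0 < Num.sqrt x by rewrite sqrtr_gt0.
  have [n nx] := dx _ sx0; exists n.
  by rewrite -[leRHS]sqr_sqrtr ?(ltW x0)//
    /e lerXn2r ?nnegrE ?(ltW (d0 _)) ?(ltW sx0).
have mg : measurable_fun setT (fun x : R => (gauss_fun x)%:E).
  by apply/measurable_EFinP; exact: measurable_gauss_fun.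
have h1 := @cvg_integral_itvcy d (fun x => (gauss_fun x)%:E) d0 dx nd mg
  (fun x => gauss_fun_ge0 x).
have h2 := @cvg_integral_itvcy e (fun x => (2^-1 * g 2^-1 x)%:E) e0 ex ne.
have mf : measurable_fun setT (fun x => (2^-1 * g 2^-1 x)%:E).
  by apply/measurable_EFinP; apply: measurable_funM => //;
    apply/measurable_EFinP; exact: measurable_gamma_integrand.
have half_ge0 : 0 <= 2^-1 :> R by rewrite invr_ge0.
have {}h2 := h2 mf (fun x => mulr_ge0 half_ge0 (gamma_integrand_ge0 _ x)).
have E : (fun n => \int[mu]_(x in `[d n, +oo[) (gauss_fun x)%:E)%E =
   (fun n => \int[mu]_(x in `[e n, +oo[) (2^-1 * g 2^-1 x)%:E)%E.
  apply/funext => n; rewrite -integral_gauss_sqrt// /e sqrtr_sqr.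
  by rewrite ger0_norm// ltW.
rewrite E in h1.
have := cvg_unique (@ereal_hausdorff R) h1 h2.
rewrite integral_itv_obnd_cbnd//; last exact: measurable_funTS.
rewrite integral0y_gauss.
under eq_integral do rewrite EFinM.
rewrite ge0_integralZl_EFin//=; last 2 first.
- by move=> x _; exact: gamma_integrand_ge0.
- exact: measurable_gamma_integrand.
move=> H; have {H} := f_equal (fun z => (2%:E * z)%E) (H _).
by rewrite muleA -!EFinM mulfV// mul1e mulrC divfK// => <-.
Qed.

(* Beyond 1 the integrand is dominated by a multiple of e^(-t/2), here written
   as an exponential density. *)
Lemma integral_gamma_fin x : 2^-1 <= x ->
  (\int[mu]_(t in `]0%R, +oo[) (g x t)%:E < +oo)%E.
Proof.
move=> x2.
have [N xN] : exists N : nat, x - 1 <= N.+1%:R.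
  by exists (Num.truncn (x - 1)); exact: ltW (truncnS_gt _).
(* From (t/2)^(N+1) / (N+1)! <= e^(t/2); the last 2 cancels the factor 1/2 of the exponential
   density. *)
pose K : R := N.+1`!%:R * 2 ^+ N.+1 * 2.
have pdf0 t : 0 <= exponential_pdf 2^-1 t by apply: exponential_pdf_ge0.
have K0 : 0 <= K by rewrite !mulr_ge0// exprn_ge0.
have bound t : `]0%R, +oo[%classic t ->
    g x t <= g 2^-1 t + K * exponential_pdf 2^-1 t.
  rewrite /= in_itv/= andbT => t0.
  (* On ]0, 1] powers decrease in the exponent, so x >= 1/2 gives the integrand of Gamma(1/2) as a
     bound. *)
  have [t1|t1] := leP t 1.
    apply: ler_wpDr; first by rewrite mulr_ge0.
    by rewrite /g ler_wpM2r ?expR_ge0// ger_powR ?t0// lerD2r.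
  apply: ler_wpDl; first exact: gamma_integrand_ge0.
  rewrite exponential_pdfE ?(ltW t0)// /g /=.
  have : expR (- t) = expR (- 2^-1 * t) * expR (- 2^-1 * t).
    by rewrite -expRD; congr expR; field.
  move=> ->; rewrite !mulrA ler_wpM2r ?expR_ge0// /K -!mulrA mulfV// mulr1.
  rewrite mulNr expRN ler_pdivrMr ?expR_gt0//.
  rewrite (@le_trans _ _ (t ^+ N.+1))//.
    by rewrite -powR_mulrn ?(ltW t0)// ler_powR ?(ltW t1).
  have := @expR_ge1Dxn R (2^-1 * t) N; rewrite mulr_ge0 ?(ltW t0)// =>
    /(_ isT) H.
  have {H} : (2^-1 * t) ^+ N.+1 / N.+1`!%:R <= expR (2^-1 * t).
    by apply: le_trans H; rewrite lerDr.
  rewrite ler_pdivrMr ?ltr0n ?fact_gt0// exprMn exprVn mulrC ler_pdivrMr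
    ?exprn_gt0//.
  by move=> /le_trans; apply; rewrite le_eqVlt; apply/orP; left; apply/eqP;
    ring.
apply: (@le_lt_trans _ _ (\int[mu]_(t in `]0%R, +oo[) ((g 2^-1 t)%:E
  + (K * exponential_pdf 2^-1 t)%:E))%E).
  apply: ge0_le_integral => //.
  - by move=> t _; rewrite lee_fin gamma_integrand_ge0.
  - exact: measurable_gamma_integrand.
  - apply: emeasurable_funD; first exact: measurable_gamma_integrand.
    apply/measurable_EFinP; apply: measurable_funM => //.
    by apply: measurable_funTS; exact: measurable_exponential_pdf.
rewrite ge0_integralD//=; last 4 first.
- by move=> t _; rewrite lee_fin gamma_integrand_ge0.
- exact: measurable_gamma_integrand.
- by move=> t _; rewrite lee_fin mulr_ge0.
- apply/measurable_EFinP; apply: measurable_funM => //.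
  by apply: measurable_funTS; exact: measurable_exponential_pdf.
rewrite integral_gamma_half.
(* Enlarging the domain to the whole line brings in the total mass 1 of the density. *)
apply: (@le_lt_trans _ _ ((Num.sqrt pi)%:E
  + \int[mu]_t (K * exponential_pdf 2^-1 t)%:E)%E).
  apply: leeD => //; apply: ge0_subset_integral => //.
  - apply/measurable_EFinP; apply: measurable_funM => //;
      exact: measurable_exponential_pdf.
  - by move=> t _; rewrite lee_fin mulr_ge0.
under eq_integral do rewrite EFinM.
rewrite ge0_integralZl_EFin//=; last 2 first.
- by move=> t _; rewrite lee_fin pdf0.
- by apply/measurable_EFinP; exact: measurable_exponential_pdf.
rewrite integral_exponential_pdf// mule1 -EFinD; exact: ltry.
Qed.

(** Finiteness ensures that the real-valued integral is not the default value 0 given to an infinite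
    one. *)
Lemma GammaE x : 2^-1 <= x ->
  (\int[mu]_(t in `]0%R, +oo[) (g x t)%:E)%E = (Gamma x)%:E.
Proof.
move=> x2; rewrite /Gamma /Rintegral fineK// ge0_fin_numE ?integral_gamma_fin//.
by apply: integral_ge0 => t _; rewrite lee_fin gamma_integrand_ge0.
Qed.

Lemma Gamma_half : Gamma (2^-1 : R) = Num.sqrt pi.
Proof. by apply: EFin_inj; rewrite -GammaE// integral_gamma_half. Qed.

(* t^(x-1) <= t^(-1/2) on ]0, 1] and t^(x-1) <= t^(y-1) on [1, +oo[. *)
Lemma Gamma_le x y : 2^-1 <= x -> x <= y -> Gamma x <= Num.sqrt pi + Gamma y.
Proof.
move=> x2 xy; have y2 := le_trans x2 xy.
rewrite -lee_fin EFinD -!GammaE// -integral_gamma_half -ge0_integralD//=;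
  last 4 first.
- by move=> t _; rewrite lee_fin gamma_integrand_ge0.
- exact: measurable_gamma_integrand.
- by move=> t _; rewrite lee_fin gamma_integrand_ge0.
- exact: measurable_gamma_integrand.
apply: ge0_le_integral => //.
- by move=> t _; rewrite lee_fin gamma_integrand_ge0.
- exact: measurable_gamma_integrand.
- by apply: emeasurable_funD; exact: measurable_gamma_integrand.
move=> t; rewrite /= in_itv/= andbT => t0; rewrite -EFinD lee_fin.
have [t1|t1] := leP t 1.
  apply: ler_wpDr; first exact: gamma_integrand_ge0.
  by rewrite /g ler_wpM2r ?expR_ge0// ger_powR ?t0// lerD2r.
apply: ler_wpDl; first exact: gamma_integrand_ge0.
by rewrite /g ler_wpM2r ?expR_ge0// ler_powR ?(ltW t1)// lerD2r.
Qed.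

(** On [1, 2] one has t^(x-1) >= 1/t >= 1/2 and e^(-t) >= e^(-2). Being uniform in x, the bound
    controls all denominators at once. *)
Lemma Gamma_ge x : 2^-1 <= x -> 2^-1 * expR (- 2) <= Gamma x.
Proof.
move=> x2; rewrite -lee_fin -GammaE//.
apply: (@le_trans _ _ (\int[mu]_(t in `[1%R, 2%R]) (g x t)%:E)%E); last first.
  apply: ge0_subset_integral => //.
  - exact: measurable_gamma_integrand.
  - by move=> t _; rewrite lee_fin gamma_integrand_ge0.
  - by move=> t /=; rewrite !in_itv/= andbT => /andP[+ _]; exact: lt_le_trans.
have <- : (\int[mu]_(t in `[1%R, 2%R]) (cst (2^-1 * expR (- 2))%:E t) =
  (2^-1 * expR (- 2))%:E)%E.
  rewrite integral_cst//= lebesgue_measure_itv/= lte_fin ltr1n/= -EFinB -EFinM.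
  by congr EFin; ring.
apply: ge0_le_integral => //.
- by move=> t _; rewrite lee_fin mulr_ge0 ?expR_ge0.
- exact: measurable_gamma_integrand.
move=> t /=; rewrite in_itv/= => /andP[t1 t2];
  rewrite lee_fin /g ler_pM ?expR_ge0//.
  rewrite (@le_trans _ _ (t `^ (-1)))//.
    by rewrite powR_inv1 ?lef_pV2 ?posrE// ?(le_trans _ t1)//
      (lt_le_trans _ t1).
  by rewrite ler_powR// lerBrDr (le_trans _ x2)// addNr invr_ge0.
by rewrite ler_expR lerN2.
Qed.

(** * Normalization, sign and growth of the Bessel-Struve coefficients *)

Lemma bessel_struve_coef0 (nu : R) : - (1 / 2) < nu ->
  bessel_struve_coef nu 0 = 1.
Proof.
move=> nu2; rewrite /bessel_struve_coef fact0 mulr1 mul0r add0r div1r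
  Gamma_half.
rewrite [X in X / _]mulrC mulfV// mulf_neq0//.
  by rewrite gt_eqF// sqrtr_gt0 pi_gt0.
have n2 : 2^-1 <= nu + 1 by lra.
by rewrite gt_eqF// (lt_le_trans _ (Gamma_ge n2))// mulr_gt0// expR_gt0.
Qed.

Lemma bessel_struve_coef_ge0 (nu : R) n : - (1 / 2) < nu ->
  0 <= bessel_struve_coef nu n.
Proof.
move=> nu2.
have G0 x : 2^-1 <= x -> 0 <= Gamma x.
  by move=> x2; rewrite (le_trans _ (Gamma_ge x2))// mulr_ge0 ?expR_ge0.
have n0 : 0 <= n%:R :> R by [].
have g1 : 0 <= Gamma (nu + 1) by apply: G0; lra.
have g2 : 0 <= Gamma (n.+1%:R / 2 : R) by apply: G0; rewrite -(natr1 n); lra.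
have g3 : 0 <= Gamma (n%:R / 2 + nu + 1) by apply: G0; lra.
by rewrite /bessel_struve_coef divr_ge0// !mulr_ge0// sqrtr_ge0.
Qed.

(** [Gamma_le] and [Gamma_ge] bound Gamma((n+1)/2) / Gamma(n/2 + nu + 1) uniformly in n, which
    leaves only 1/n!. *)
Lemma bessel_struve_coef_le (nu : R) : - (1 / 2) < nu ->
  exists2 K, 0 <= K & forall n, bessel_struve_coef nu n <= K / n`!%:R.
Proof.
move=> nu2.
pose s : R := Num.sqrt pi; have s0 : 0 < s by rewrite sqrtr_gt0 pi_gt0.
pose d : R := 2^-1 * expR (- 2); have d0 : 0 < d by rewrite mulr_gt0 ?expR_gt0.
have G0 : 0 <= Gamma (nu + 1).
  have n2 : 2^-1 <= nu + 1 by lra.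
  by rewrite (le_trans _ (Gamma_ge n2))// mulr_ge0// expR_ge0.
exists (Gamma (nu + 1) / s * (s / d + 1)).
  by rewrite !mulr_ge0 ?invr_ge0 ?addr_ge0 ?divr_ge0// ltW.
move=> n; have n0 : 0 <= n%:R :> R by [].
have y2 : 2^-1 <= n%:R / 2 + nu + 1 by lra.
have x2 : 2^-1 <= n.+1%:R / 2 :> R by rewrite -(natr1 n); lra.
(* This comparison of the two Gamma arguments amounts to nu >= -1/2. *)
have xy : n.+1%:R / 2 <= n%:R / 2 + nu + 1 by rewrite -(natr1 n); lra.
set y := _ + 1 in y2 xy; have Gy := Gamma_ge y2; rewrite -/d in Gy.
have Gy0 : 0 < Gamma y by exact: lt_le_trans Gy.
rewrite /bessel_struve_coef -/s -/y.
have -> : Gamma (nu + 1) * Gamma (n.+1%:R / 2) / (s * n`!%:R * Gamma y) =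
   Gamma (nu + 1) / s * (Gamma (n.+1%:R / 2) / Gamma y) / n`!%:R.
  by field; rewrite !gt_eqF// ltr0n fact_gt0.
rewrite ler_wpM2r// ler_wpM2l ?divr_ge0 ?(ltW s0)//.
rewrite ler_pdivrMr// (le_trans (Gamma_le x2 xy))//.
rewrite mulrDl mul1r lerD2r -/s mulrAC ler_pdivlMr// ler_wpM2l// ltW//.
Qed.

End GammaFunction.

(** * The coefficient criterion *)

Section CoefficientCriterion.
Variable R : realType.
Notation C := (Cplx R).
Implicit Types (z w : C).
Variables (c : nat -> R) (alpha lambda : R).
Hypotheses (ec : entire c) (c0 : c 0%N = 1) (c_ge0 : forall n, 0 <= c n).
Hypotheses (halpha0 : 0 <= alpha) (halpha1 : alpha < 1).
Hypotheses (hlambda0 : 0 <= lambda) (hlambda1 : lambda < 1).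

(* [weight n] is the coefficient of index n + 1, not n, in the hypothesis. *)
Let weight n : R := (n.+2%:R - alpha) * (lambda * n.+1%:R + 1) * c n.+1.
Hypothesis weight_le : forall N, series weight N <= 1 - alpha.

Let f z : C := z * psum c z.

Let weight_ge0 n : 0 <= weight n.
Proof.
have n0 : 0 <= n%:R :> R by [].
have h : 0 <= n.+2%:R - alpha.
  by rewrite subr_ge0 (le_trans (ltW halpha1))// ler1n.
by rewrite /weight mulr_ge0// mulr_ge0// addr_ge0// mulr_ge0.
Qed.

Lemma shifted_id_lipschitz z w r : cabs z <= r -> cabs w <= r -> r < 1 ->
  cabs (f z - f w - (z - w)) <= r * cabs (z - w).
Proof.
move=> zr wr r1; have r0 : 0 <= r by exact: le_trans (cabs_ge0 z) zr.
rewrite -ler_RtoC -normcRE.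
pose v n := RtoC (c n) * (z ^+ n.+1 - w ^+ n.+1).
have vl : series v @ \oo --> f z - f w.
  rewrite (_ : series v = fun n => z * series (fun n => RtoC (c n) * z ^+ n) n
    - w * series (fun n => RtoC (c n) * w ^+ n) n).
    by apply: cvgB; apply: cvgM; try exact: cvg_cst; exact: psum_cvg.
  apply/funext => n; rewrite /series/= !mulr_sumr -sumrB; apply: eq_bigr => k _.
  by rewrite /v !exprS; ring.
(* The term removed, of index 0, is z - w because c_0 = 1. *)
have := cvg_series_behead vl; rewrite {2}/v c0 rmorph1 mul1r !expr1.
apply: (@norm_lim_series_le _ _ (fun n =>
  weight n * ((1 - alpha)^-1 * r * cabs (z - w)))).
  move=> n; rewrite /v normrM norm_RtoC (ger0_norm (c_ge0 _)) normcRE -rmorphM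
    ler_RtoC.
  rewrite (@le_trans _ _ (c n.+1 * (n.+2%:R * r ^+ n.+1 * cabs (z - w))))//.
    by rewrite ler_wpM2l// ler_cabs_subX.
  rewrite !mulrA ler_wpM2r ?cabs_ge0// ler_pM ?mulr_ge0 ?exprn_ge0//.
    rewrite ler_pdivlMr ?subr_gt0// /weight [leRHS]mulrC -mulrA ler_wpM2l//.
    have n0 : 0 <= n%:R :> R by [].
    (* The two sides of the goal differ exactly by the sum of the quantities in [h1] and [h2]. *)
    have h1 : 0 <= (n%:R + 1 + 1 - alpha) * (lambda * (n%:R + 1)).
      by apply: mulr_ge0; [have := halpha1; lra|rewrite mulr_ge0// addr_ge0].
    have h2 : 0 <= alpha * (n%:R + 1) by rewrite mulr_ge0// addr_ge0.
    rewrite -(natr1 n.+1) -(natr1 n); nra.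
  by rewrite -[leRHS]expr1 ler_wiXn2l// ltW.
move=> N; rewrite /series/= -mulr_suml.
rewrite -[leRHS]mul1r -!mulrA [X in _ <= X]mul1r.
rewrite [leLHS]mulrA ler_piMl ?mulr_ge0 ?cabs_ge0//.
by rewrite ler_pdivrMr ?subr_gt0// mul1r; exact: weight_le.
Qed.

Lemma injective_f : {in @unit_disk R &, injective f}.
Proof.
move=> z w; rewrite !inE => /cabs_unit_disk z1 /cabs_unit_disk w1 fzw.
(* For f z = f w the Lipschitz bound reads |z - w| <= r |z - w| with r < 1. *)
pose r := Num.max (cabs z) (cabs w).
have r1 : r < 1 by rewrite gt_max z1 w1.
have := @shifted_id_lipschitz z w r; rewrite !le_max !lexx orbT =>
  /(_ isT isT r1).
rewrite fzw subrr add0r (_ : cabs (- (z - w)) = cabs (z - w)); last first.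
  by rewrite -mulN1r cabsM /cabs normrN1/= mul1r.
have := cabs_ge0 (z - w); rewrite le_eqVlt => /predU1P[/esym/cabs0_eq0/eqP|d0].
  by rewrite subr_eq0 => /eqP.
by rewrite ler_pMl// leNgt r1.
Qed.

(** Coefficients of the denominator (1 - lambda) f + lambda z f' after division by z. *)
Let B n : R := (1 + lambda * n%:R) * c n.

Let eB : entire B.
Proof.
have := entire_lin 1 lambda ec (entireM_nat ec); congr entire.
by apply/funext => n; rewrite /B; ring.
Qed.

Lemma psum_B_estimate z : cabs z <= 1 -> cabs (psum (fun n => n%:R * B n) z) +
    (1 - alpha) * cabs (psum B z - 1) <= (1 - alpha) * cabs z.
Proof.
move=> z1; have a0 : 0 <= 1 - alpha by rewrite subr_ge0 ltW.
have cR x : 0 <= x -> cabs (RtoC x) = x.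
  by move=> x0; apply: RtoC_inj; rewrite -normcRE norm_RtoC ger0_norm.
have B0 n : 0 <= B n by rewrite /B mulr_ge0// addr_ge0// mulr_ge0.
have h1 := cvg_series_behead (psum_cvg (z := z) (entireM_nat eB)).
have h2 := cvg_series_behead (psum_cvg (z := z) eB).
rewrite mul0r rmorph0 mul0r subr0 in h1.
have B00 : B 0 = 1 by rewrite /B mulr0 addr0 mul1r.
rewrite B00 rmorph1 mul1r expr0 in h2.
apply: norm_lim2_le h1 h2 => // N.
apply: (@le_trans _ _ (series weight N * cabs z));
  last by rewrite ler_wpM2r ?cabs_ge0.
rewrite (le_trans (lerD (ler_cabs_series _ _)
  (ler_wpM2l a0 (ler_cabs_series _ _))))//.
rewrite mulr_sumr -big_split/= /series/= mulr_suml; apply: ler_sum => n _.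
rewrite !cabsM !cabsX (cR _ _ (B0 _)) (cR _ _ (mulr_ge0 (ler0n _ _) (B0 _))).
(* At index n + 1 the factors n + 1 and 1 - alpha add up to n + 2 - alpha. *)
rewrite (_ : _ + _ = weight n * cabs z ^+ n.+1); last first.
  by rewrite /weight /B -(natr1 n.+1); ring.
by rewrite ler_wpM2l// -[leRHS]expr1 ler_wiXn2l// cabs_ge0.
Qed.

Lemma Re_quotient_gt z : cabs z < 1 ->
  psum B z != 0 /\
  alpha < complex.Re (psum (fun n => n.+1%:R * B n) z / psum B z).
Proof.
move=> z1; have a0 : 0 < 1 - alpha by rewrite subr_gt0.
have h := psum_B_estimate (ltW z1).
set P0 := psum B z in h *; set Q := psum _ z in h.
have -> : psum (fun n => n.+1%:R * B n) z = Q + P0.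
  have := psum_lin 1 1 z (entireM_nat eB) eB.
  rewrite !rmorph1 !mul1r => <-; congr psum; apply/funext => n.
  by rewrite -natr1; ring.
(* Combines 1 - |P0 - 1| <= |P0| with the estimate, made strict by |z| < 1. It yields both P0 != 0
   and |Q / P0| < 1 - alpha. *)
have QP : cabs Q < (1 - alpha) * cabs P0.
  have := ler_cabsD (P0 - 1) (- P0).
  rewrite addrAC subrr add0r (_ : cabs (- 1) = 1);
    last by rewrite /cabs normrN1.
  rewrite (_ : cabs (- P0) = cabs P0); last by rewrite /cabs normrN.
  have : (1 - alpha) * cabs z < 1 - alpha by rewrite gtr_pMr.
  nra.
have P00 : P0 != 0.
  apply/eqP => P00; move: QP; rewrite P00 /cabs normr0 /= mulr0.
  by rewrite ltNge -/(cabs Q) cabs_ge0.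
split=> //; rewrite mulrDl mulfV// raddfD/=.
have : cabs (Q / P0) < 1 - alpha.
  by rewrite -(ltr_pM2r (_ : 0 < cabs P0)) -?cabsM ?divfK//
    lt_neqAle cabs_ge0 andbT eq_sym;
    apply: contra P00 => /eqP/cabs0_eq0 ->.
have := Re_le_cabs (Q / P0); rewrite ler_norml => /andP[+ _].
have := halpha1; lra.
Qed.

Lemma f_psumE : f = psum (cons0 c).
Proof. by apply/funext => z; rewrite psum_cons0. Qed.

Lemma class_T_f : class_T lambda alpha f.
Proof.
have ea := entire_cons0 ec; have eda := entire_diffs ea.
split.
  split.
  - by move=> z _; rewrite f_psumE; have [] := is_derive_psum z ea.
  - exact: injective_f.
  - by rewrite /f mul0r.
  - by rewrite f_psumE derive1_psum// psum0// /pseries_diffs/= mul1r c0 rmorph1.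
move=> z /cabs_unit_disk z1; rewrite /T_quotient; case: eqVneq => [_|z0].
  exact: halpha1.
have [P00 aP] := Re_quotient_gt z1.
have dd : f^`(2)%classic = psum (pseries_diffs (pseries_diffs (cons0 c))).
  by rewrite derive1nS derive1n1 f_psumE !derive1_psum.
rewrite dd f_psumE derive1_psum//.
rewrite -[RtoC lambda * _ * _]mulrA psum_diffs2//
  -[RtoC lambda * _ * _]mulrA psum_diffs//.
(* At index n + 1 of [cons0 c]: (n + 1) + lambda (n + 1) n = (n + 1) (1 + lambda n). *)
have -> : psum (fun n => n%:R * cons0 c n) z +
    RtoC lambda * psum (fun n => n%:R * (n%:R - 1) * cons0 c n) z =
    z * psum (fun n => n.+1%:R * B n) z.
  have e1 := entireM_nat ea.
  have e2 := entireM_nat2 ea.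
  have := psum_lin 1 lambda z e1 e2; rewrite rmorph1 mul1r => <-.
  have e3 : entire (fun n => n.+1%:R * B n).
    have := entire_lin 1 1 (entireM_nat eB) eB; congr entire.
    by apply/funext => n; rewrite -natr1; ring.
  rewrite -psum_cons0//; congr psum; apply/funext => -[|n]/=; first by ring.
  by rewrite /B -natr1; ring.
have -> : (1 - RtoC lambda) * psum (cons0 c) z +
    RtoC lambda * psum (fun n => n%:R * cons0 c n) z = z * psum B z.
  rewrite -(rmorph1 (@RtoC R)) -rmorphB -psum_lin//; last exact: entireM_nat.
  rewrite -psum_cons0//; congr psum; apply/funext => -[|n]/=; first by ring.
  by rewrite /B -natr1; ring.
by rewrite invfM mulrACA mulfV// mul1r.
Qed.

End CoefficientCriterion.

(** * From the inequality at z = 1 to the coefficient criterion *)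

Theorem theorem2p1 (R : realType) (nu alpha lambda : R)
    (hnu : - (1 / 2) < nu)
    (halpha0 : 0 <= alpha) (halpha1 : alpha < 1)
    (hlambda0 : 0 <= lambda) (hlambda1 : lambda < 1)
    (hS : complex.Re
            (RtoC lambda * (bessel_struve nu)^`(2)%classic 1
             + RtoC (1 - lambda * alpha + 2 * lambda)
                 * (bessel_struve nu)^`()%classic 1
             + RtoC (1 - alpha) * bessel_struve nu 1)
          <= 2 * (1 - alpha)) :
  class_T lambda alpha (fun z : Cplx R => z * bessel_struve nu z).
Proof.
pose c := bessel_struve_coef nu.
have cge0 n : 0 <= c n by exact: bessel_struve_coef_ge0.
have c0 : c 0%N = 1 by exact: bessel_struve_coef0.
have ec : entire c.
  have [K K0 hK] := bessel_struve_coef_le hnu.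
  by apply: (entire_le_fact K0) => n; rewrite ger0_norm.
have Sc : @bessel_struve R nu = psum c by [].
rewrite Sc in hS *; clearbody c.
apply: (class_T_f ec c0 cge0) => // N.
(* Factored form of the coefficients in the hypothesis, with index 0 included, so that [w n.+1] is
   the weight of index n. *)
pose w n : R := (n.+1%:R - alpha) * (lambda * n%:R + 1) * c n.
have e1 := entireM_nat ec.
have e2 := entireM_nat2 ec.
have e12 := entire_lin lambda (1 - lambda * alpha + 2 * lambda) e2 e1.
have wE : (fun n => 1 * (lambda * (n%:R * (n%:R - 1) * c n) +
     (1 - lambda * alpha + 2 * lambda) * (n%:R * c n)) + (1 - alpha) * c n) = w.
  by apply/funext => n; rewrite /w -natr1; ring.
have ew : entire w by rewrite -wE; exact: entire_lin.
have w0 n : 0 <= w n.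
  have h : 0 <= n.+1%:R - alpha.
    by rewrite subr_ge0 (le_trans (ltW halpha1))// ler1n.
  by rewrite /w mulr_ge0// mulr_ge0// addr_ge0// mulr_ge0.
have hw : complex.Re (psum w 1) <= 2 * (1 - alpha).
  move: hS; rewrite derive1nS derive1n1 !derive1_psum//;
    last exact: entire_diffs.
  (* At z = 1 the powers of z in these identities are 1. *)
  rewrite -wE psum_lin// psum_lin// -psum_diffs2// -psum_diffs//.
  by rewrite expr1n rmorph1 !mul1r.
clear hS.
(* Adding the term w 0 = 1 - alpha to both sides accounts for the 2 in the hypothesis. *)
rewrite -(lerD2l (1 - alpha)) -mulr2n -mulr_natl (le_trans _ hw)//.
apply: le_trans (series_le_Re_psum N.+1 ew w0).
have w00 : w 0 = 1 - alpha by rewrite /w c0 mulr0 add0r !mulr1.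
by rewrite /series/= big_nat_recl// w00.
Qed.
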